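(* Let $N\ge1$ and fix $\epsilon,\delta\in(0,1)$ such that $\delta\le 1-(1-\epsilon)^{1/N}$. Suppose there exists a policy $\pi=(\kappa_k)_{k=0}^{N-1}$, $\kappa_k:\mathbb{R}^n\to U$, such that for all $x\in S$ and all $k\in\{0,\dots,N-1\}$ the following holds: there are $\delta^{(i)}\in(0,1)$, $i\in[n_P]$, with $\sum_{i\in[n_P]}\delta^{(i)}\le\delta$, such that for each $i\in[n_P]$ there exists $j\in[m_i]$ with $$c_{ij}^\top f(x,\kappa_k(x))-\tilde b_{ij}(x)\ \ge\ -\,q_{\delta^{(i)}}\big(c_{ij}^\top g(x,\xi)\big).$$ Then $h$ is a $\delta$-probabilistic control barrier function, and $P_N(x;\pi)\le\epsilon$ for every initial state $x\in S$.
   Context: For $k\in\mathbb{N}$, $[k]=\{1,\dots,k\}$. Consider the system $x_{k+1}=F(x_k,u_k,\xi_k)=f(x_k,u_k)+g(x_k,\xi_k)$, with states $x_k\in\mathbb{R}^n$, inputs $u_k\in U\subseteq\mathbb{R}^m$ ($U$ nonempty, closed, convex), and $(\xi_k)_k$ an i.i.d. sequence of $\mathbb{R}^{n_\xi}$-valued random variables with common law $\mathbb{P}_\xi$; $\xi$ denotes a generic random variable with law $\mathbb{P}_\xi$. Here $\xi_k$ is independent of the information available at time $k$ (in particular of $x_k$), and $u_k$ depends causally on the randomness; $f$, $g$ and the policies are measurable. The constant $\alpha\in[0,1]$ is fixed. The function $h:\mathbb{R}^n\to\mathbb{R}$ is $$h(x)=\min_{i\in[n_P]}h_i(x),\qquad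 h_i(x)=\max_{j\in[m_i]}\big(c_{ij}^\top x-b_{ij}\big),$$ with $n_P,m_i\ge1$ integers, $c_{ij}\in\mathbb{R}^n$, $b_{ij}\in\mathbb{R}$; the safe set is $S=\{x:h(x)\ge0\}$, and $\tilde b_{ij}(x)=b_{ij}+\alpha h(x)$. For a real random variable $Z$, $q_\delta(Z)=\inf\{\tau:\mathbb{P}\{Z\le\tau\}\ge\delta\}$ (in the quantile above $x$ is fixed and $\xi\sim\mathbb{P}_\xi$). $h$ is a $\delta$-probabilistic control barrier function if there exists $\alpha\in[0,1]$ such that for all $x\in S$ there is $u\in U$ with $\mathbb{P}_\xi\{h(F(x,u,\xi))\ge\alpha h(x)\}\ge1-\delta$. The $N$-step exit probability from initial state $x_0=x\in S$ under $\pi$ is $P_N(x;\pi)=\mathbb{P}\{\exists k\in[N]: x_k\notin S\}$, where $(x_k)$ is generated by the dynamics with $u_k=\kappa_k(x_k)$. *)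

(* Defs.v *)
From HB Require Import structures.
From mathcomp Require Import all_boot all_order all_algebra finmap.
From mathcomp Require Import all_classical all_reals all_analysis.

Set Implicit Arguments.
Unset Strict Implicit.
Unset Printing Implicit Defensive.

Import Order.TTheory GRing.Theory Num.Theory.
Import numFieldTopology.Exports numFieldNormedType.Exports.

Local Open Scope classical_set_scope.
Local Open Scope ring_scope.

(* Matrices, hence the column vectors used for R^n, carry the Borel
   sigma-algebra of their topology. *)
HB.instance Definition _ (R : realType) (m n : nat) :=
  @isMeasurable.Build (sigma_display (@open 'M[R]_(m, n))) 'M[R]_(m, n)
    <<s @open 'M[R]_(m, n) >>
    (@sigma_algebra0 _ setT (@open 'M[R]_(m, n)))
    (@sigma_algebraC _ (@open 'M[R]_(m, n)))
    (@sigma_algebra_bigcup _ setT (@open 'M[R]_(m, n))).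

Definition dotv (R : realType) (n : nat) (c x : 'cV[R]_n) : R :=
  (c^T *m x) ord0 ord0.

(* Minimum and maximum of a nonempty finite family; the seed of the big
   operator is a member of the family, so it does not affect the value. *)
Definition min_fam (R : realType) (k : nat) (F : 'I_k.+1 -> R) : R :=
  \big[Order.min/F ord0]_(i < k.+1) F i.

Definition max_fam (R : realType) (k : nat) (F : 'I_k.+1 -> R) : R :=
  \big[Order.max/F ord0]_(i < k.+1) F i.

(* The successors rule out empty families: there are p.+1 pieces h_i, the i-th
   one being a maximum of (q i).+1 affine functions. *)
Section PiecewiseAffine.
Context (R : realType) (n p : nat) (q : 'I_p.+1 -> nat).
Context (c : forall i : 'I_p.+1, 'I_(q i).+1 -> 'cV[R]_n).
Context (b : forall i : 'I_p.+1, 'I_(q i).+1 -> R).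

Definition hpiece (i : 'I_p.+1) (x : 'cV[R]_n) : R :=
  max_fam (fun j : 'I_(q i).+1 => dotv (c j) x - b j).

Definition hfun (x : 'cV[R]_n) : R := min_fam (fun i => hpiece i x).

Definition btilde (alpha : R) (i : 'I_p.+1) (j : 'I_(q i).+1)
  (x : 'cV[R]_n) : R := b j + alpha * hfun x.

End PiecewiseAffine.

Definition safe_set (R : realType) (n : nat) (h : 'cV[R]_n -> R) :
  set 'cV[R]_n := [set x | 0 <= h x].

(* For 0 < delta < 1 the set below is nonempty and bounded below, so the
   real-valued infimum is the genuine one. *)
Definition quantile (R : realType) (d : measure_display)
    (T : measurableType d) (P : probability T R) (Z : T -> R) (delta : R) : R :=
  inf [set tau : R | (delta%:E <= P [set t | (Z t <= tau)%R])%E].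

Definition mutually_independent (R : realType) (d d' : measure_display)
    (Omega : measurableType d) (T : measurableType d') (P : probability Omega R)
    (X : nat -> {RV P >-> T}) : Prop :=
  forall (J : {fset nat}) (A : nat -> set T),
    (forall k, measurable (A k)) ->
    P (\bigcap_(k in [set` J]) (X k @^-1` A k)) =
    (\prod_(k <- J) P (X k @^-1` A k))%E.

Definition iid_with_law (R : realType) (d d' : measure_display)
    (Omega : measurableType d) (T : measurableType d') (P : probability Omega R)
    (X : nat -> {RV P >-> T}) (mu : probability T R) : Prop :=
  mutually_independent X /\
  (forall k (A : set T), measurable A -> distribution P (X k) A = mu A).

Section Dynamics.
Context (R : realType) (n m r : nat).
Context (f : 'cV[R]_n -> 'cV[R]_m -> 'cV[R]_n).
Context (g : 'cV[R]_n -> 'cV[R]_r -> 'cV[R]_n).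

Definition dyn (x : 'cV[R]_n) (u : 'cV[R]_m) (z : 'cV[R]_r) : 'cV[R]_n :=
  f x u + g x z.

Definition is_prob_CBF (U : set 'cV[R]_m) (law : probability 'cV[R]_r R)
    (delta : R) (h : 'cV[R]_n -> R) : Prop :=
  exists alpha : R, 0 <= alpha <= 1 /\
    forall x, safe_set h x -> exists u, U u /\
      ((1 - delta)%:E <= law [set z | (alpha * h x <= h (dyn x u z))%R])%E.

Fixpoint trajectory (Omega : Type) (kappa : nat -> 'cV[R]_n -> 'cV[R]_m)
    (xi : nat -> Omega -> 'cV[R]_r) (x0 : 'cV[R]_n) (k : nat) (w : Omega) :
    'cV[R]_n :=
  if k is k'.+1 then
    let x := trajectory kappa xi x0 k' w in dyn x (kappa k' x) (xi k' w)
  else x0.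

Definition exit_prob (d : measure_display) (Omega : measurableType d)
    (P : probability Omega R) (kappa : nat -> 'cV[R]_n -> 'cV[R]_m)
    (xi : nat -> Omega -> 'cV[R]_r) (S : set 'cV[R]_n) (N : nat)
    (x0 : 'cV[R]_n) : \bar R :=
  P [set w | exists k, (1 <= k <= N)%N /\ ~ S (trajectory kappa xi x0 k w)].

End Dynamics.

(* Main.v *)
(** If [q_d] is the [d]-quantile of [Z] and [d > 0], then [Z < q_d] has
    probability at most [d]. At a safe point a union bound over the pieces
    [h_i] therefore gives [h (F (x, u, xi)) >= alpha h x] with probability at
    least [1 - delta], and [alpha h x >= 0] makes the next state safe. Given
    survival up to time [k], the state [x_k] is independent of [xi_k], so their
    joint law is a product measure and integrating the one-step bound shows that
    each step multiplies the survival probability by at least [1 - delta]. After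
    [N] steps it is at least [(1 - delta)^N >= 1 - eps]. *)

Require Import Defs.
From HB Require Import structures.
From mathcomp Require Import all_boot all_order all_algebra finmap.
From mathcomp Require Import all_classical all_reals all_analysis.
From mathcomp Require Import measurable_realfun.
From mathcomp Require Import lra.

Set Implicit Arguments.
Unset Strict Implicit.
Unset Printing Implicit Defensive.

Import Order.TTheory GRing.Theory Num.Theory.
Import numFieldTopology.Exports numFieldNormedType.Exports.

Local Open Scope classical_set_scope.
Local Open Scope ring_scope.

(** * Borel measurability of matrix-valued maps and of the barrier function *)

Lemma open_measurable_mx (R : realType) (m n : nat) (A : set 'M[R]_(m, n)) :
  open A -> measurable A.
Proof. exact: sub_sigma_algebra. Qed.

Lemma closed_measurable_mx (R : realType) (m n : nat) (A : set 'M[R]_(m, n)) :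
  closed A -> measurable A.
Proof.
by move/closed_openC/open_measurable_mx/measurableC; rewrite setCK.
Qed.

Lemma measurable_coord (R : realType) (m n : nat) (i : 'I_m) (j : 'I_n) :
  measurable_fun setT (fun M : 'M[R]_(m, n) => M i j).
Proof.
apply: (measurability _ (RGenOpens.measurableE R)).
move=> _ [_ [a [b ->]] <-]; rewrite setTI.
apply: open_measurable_mx; apply: open_comp; last exact: interval_open.
by move=> M _; exact: coord_continuous.
Qed.

Definition rat_box (R : realType) (m n : nat) (e : 'M[rat * rat]_(m, n)) :
  set 'M[R]_(m, n) :=
  [set M | forall i j, ball (ratr (e i j).1 : R) (ratr (e i j).2) (M i j)].

(** Matrix neighbourhoods are entrywise, and each entry fits in a ball with rational centre and
    radius. The union is countable because its index set consists of rational matrices. *)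
Lemma open_rat_box (R : realType) (m n : nat) (A : set 'M[R]_(m, n)) :
  open A -> A = \bigcup_(e in [set e | rat_box e `<=` A]) rat_box e.
Proof.
move=> oA; apply/seteqP; split => [M AM|M [e eA]]; last exact: eA.
have [Q QM QA] : nbhs M A by exact: open_nbhs_nbhs.
have ratQ i j : exists cr : rat * rat,
    ball (ratr cr.1 : R) (ratr cr.2) (M i j) /\
    ball (ratr cr.1 : R) (ratr cr.2) `<=` Q i j.
  (* [Q i j] is only a neighbourhood of [M i j]; rational balls are extracted from open sets, hence
     the interior. *)
  have MQ : M i j \in (interior (Q i j) : set R) by rewrite inE; exact: QM.
  have [c [r [+ sub]]] := open_subball_rat (@open_interior _ (Q i j)) MQ.
  rewrite inE => Mcr; exists (c, r); split => //=.
  exact: subset_trans sub (@interior_subset _ _).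
pose e : 'M[rat * rat]_(m, n) := \matrix_(i, j) sval (cid (ratQ i j)).
exists e => [|i j] /=; last first.
  by rewrite mxE; case: cid => cr [].
move=> M' M'e; apply: QA => i j; have := M'e i j; rewrite mxE.
by case: cid => cr [_ /= +] ?; exact.
Qed.

(** By [open_rat_box], the preimage of an open set is a countable union of finite intersections of
    preimages of intervals under the entries. This reduces sums and pairings of vectors to
    real-valued functions. *)
Lemma measurable_fun_mx (R : realType) (m n : nat) d (T : measurableType d)
    (F : T -> 'M[R]_(m, n)) :
  (forall i j, measurable_fun setT (fun t => F t i j)) -> measurable_fun setT F.
Proof.
move=> mF.
apply: (@measurability _ _ T _ setT F (@open 'M[R]_(m, n)) erefl) => _ [A oA <-].
rewrite setTI.
rewrite (open_rat_box oA) preimage_bigcup bigcup_mkcond.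
apply: countable_bigcupT_measurable; first exact: countableP.
move=> e; case: ifP => // _.
rewrite (_ : _ @^-1` _ = \bigcap_(ij in [set: 'I_m * 'I_n])
   (fun t => F t ij.1 ij.2) @^-1`
     ball (ratr (e ij.1 ij.2).1 : R) (ratr (e ij.1 ij.2).2)); last first.
  by apply/seteqP; split => [t Ft [i j] _|t Ft i j]; [exact: Ft|exact: (Ft (i, j))].
apply: fin_bigcap_measurable => // -[i j] _ /=.
rewrite -[X in measurable X]setTI; apply: mF => //.
by rewrite ball_itv; exact: measurable_itv.
Qed.

Lemma measurable_addmx (R : realType) (m n : nat) d (T : measurableType d)
    (F G : T -> 'M[R]_(m, n)) :
  measurable_fun setT F -> measurable_fun setT G ->
  measurable_fun setT (fun t => F t + G t).
Proof.
move=> mF mG; apply: measurable_fun_mx => i j.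
under eq_fun do rewrite mxE.
by apply: measurable_funD; apply: measurableT_comp (@measurable_coord R m n i j) _.
Qed.

Lemma measurable_dotv (R : realType) (n : nat) (c : 'cV[R]_n) :
  measurable_fun setT (dotv c).
Proof.
rewrite /dotv; under eq_fun do rewrite mxE.
apply: measurable_sum => i; apply: measurable_funM => //.
exact: measurable_coord.
Qed.

Lemma dotvD (R : realType) (n : nat) (c x y : 'cV[R]_n) :
  dotv c (x + y) = dotv c x + dotv c y.
Proof. by rewrite /dotv mulmxDr mxE. Qed.

Lemma measurable_bigmin (R : realType) d (T : measurableType d) (I : Type)
    (s : seq I) (x0 : T -> R) (F : I -> T -> R) :
  measurable_fun setT x0 -> (forall i, measurable_fun setT (F i)) ->
  measurable_fun setT (fun t => \big[Order.min/x0 t]_(i <- s) F i t).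
Proof.
move=> mx0 mF; elim: s => [|i s IH]; first by under eq_fun do rewrite big_nil.
by under eq_fun do rewrite big_cons; exact: measurable_minr.
Qed.

Lemma measurable_bigmax (R : realType) d (T : measurableType d) (I : Type)
    (s : seq I) (x0 : T -> R) (F : I -> T -> R) :
  measurable_fun setT x0 -> (forall i, measurable_fun setT (F i)) ->
  measurable_fun setT (fun t => \big[Order.max/x0 t]_(i <- s) F i t).
Proof.
move=> mx0 mF; elim: s => [|i s IH]; first by under eq_fun do rewrite big_nil.
by under eq_fun do rewrite big_cons; exact: measurable_maxr.
Qed.

Lemma measurable_hfun (R : realType) (n p : nat) (q : 'I_p.+1 -> nat)
    (c : forall i : 'I_p.+1, 'I_(q i).+1 -> 'cV[R]_n)
    (b : forall i : 'I_p.+1, 'I_(q i).+1 -> R) :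
  measurable_fun setT (hfun c b).
Proof.
have mh i : measurable_fun setT (hpiece c b i).
  by apply: measurable_bigmax => [|j]; apply: measurable_funB => //;
    exact: measurable_dotv.
exact: measurable_bigmin.
Qed.

Lemma hfun_ge (R : realType) (n p : nat) (q : 'I_p.+1 -> nat)
    (c : forall i : 'I_p.+1, 'I_(q i).+1 -> 'cV[R]_n)
    (b : forall i : 'I_p.+1, 'I_(q i).+1 -> R) (a : R) (x : 'cV[R]_n) :
  (forall i, exists j, a <= dotv (c i j) x - b i j) -> a <= hfun c b x.
Proof.
move=> ha; have hi i : a <= hpiece c b i x.
  have [j /le_trans] := ha i; apply.
  exact: (le_bigmax _ (fun j => dotv (c i j) x - b i j)).
exact: le_bigmin.
Qed.

(** * Quantiles *)

(** The distribution function tends to 0 at minus infinity, so it is below [delta] left of some [M].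
    This makes [inf] a true lower bound of the set rather than a default value. *)
Lemma quantile_set_lbound (R : realType) d (T : measurableType d)
    (P : probability T R) (Z : T -> R) (delta : R) :
  measurable_fun setT Z -> 0 < delta ->
  has_lbound [set tau : R | (delta%:E <= P [set t | (Z t <= tau)%R])%E].
Proof.
move=> mZ d0; pose X : {RV P >-> R} := mfun_Sub (mem_set mZ : Z \in mfun).
have /(cvg_cdfNy0 X)[M [_ cdfM]] : nbhs 0%:E [set y | (y < delta%:E)%E].
  apply: open_nbhs_nbhs; split; first exact: open_ereal_lt_ereal.
  by rewrite /= lte_fin.
exists M => tau /= dtau; rewrite leNgt; apply/negP => /cdfM.
by rewrite /= ltNge => /negP; apply.
Qed.

(** Continuity from below along the events [Z <= q - 1/(k+1)]: if one of them had probability above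
    [delta], then [q - 1/(k+1)] would lie in the set whose infimum is [q]. *)
Lemma quantile_lt_le (R : realType) d (T : measurableType d)
    (P : probability T R) (Z : T -> R) (delta : R) :
  measurable_fun setT Z -> 0 < delta ->
  (P [set t | (Z t < quantile P Z delta)%R] <= delta%:E)%E.
Proof.
move=> mZ d0; set q := quantile P Z delta.
pose F k := [set t | Z t <= q - k.+1%:R^-1].
have mF k : measurable (F k).
  by rewrite -[F k]setTI; exact: measurable_fun_le.
have FE : [set t | Z t < q] = \bigcup_k F k.
  apply/seteqP; split => t /=; last first.
    by move=> [k _ /le_lt_trans]; apply; rewrite ltrBlDr ltrDl invr_gt0 ltr0n.
  by move=> /ltr_add_invr[k Zk]; exists k; rewrite // /F /= lerBrDr ltW.
have ndF : nondecreasing_seq F.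
  move=> i j ij; apply/subsetPset => t /= /le_trans; apply.
  by rewrite lerD2l lerN2 lef_pV2 ?posrE ?ltr0n ?ler_nat.
have := @nondecreasing_cvg_mu _ _ _ P F mF (bigcup_measurable (fun k _ => mF k)) ndF.
rewrite FE => cvgF; rewrite -(cvg_lim _ cvgF)//.
apply: lime_le; first by apply/cvg_ex; eexists; exact: cvgF.
apply: nearW => k /=; rewrite leNgt; apply/negP => /ltW dF.
have := ge_inf (quantile_set_lbound P mZ d0) dF.
rewrite -/(quantile P Z delta) -/q lerBrDr gerDl.
by rewrite leNgt invr_gt0 ltr0n.
Qed.

(** * Uniqueness of finite measures on a product *)

(** Rectangles are stable under intersection and generate the product sigma-algebra. The whole space
    is a rectangle of finite measure, so the constant sequence [setT] serves as the exhaustion. *)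
Lemma prod_measure_eq d1 d2 (T1 : measurableType d1) (T2 : measurableType d2)
    (R : realType) (m1 m2 : {measure set (T1 * T2) -> \bar R}) :
  (m1 setT < +oo)%E ->
  (forall A B, measurable A -> measurable B -> m1 (A `*` B) = m2 (A `*` B)) ->
  forall D, measurable D -> m1 D = m2 D.
Proof.
move=> m1oo m12.
apply: (measure_unique [set A `*` B | A in measurable & B in measurable]
  (fun=> setT)).
- exact: measurable_prod_measurableType.
- move=> _ _ [A mA [B mB <-]] [C mC [D mD <-]]; rewrite -setXI.
  exists (A `&` C); first exact: measurableI.
  by exists (B `&` D) => //; exact: measurableI.
- by move=> _; exists setT => //; exists setT => //; rewrite setXTT.
- by rewrite bigcup_const//; exists 0%N.
- by move=> _ [A mA [B mB <-]]; exact: m12.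
- by [].
Qed.

(** * The one-step probability bound *)

(** Fix one admissible [j i] per piece. Outside the events where [Z i] falls below its quantile,
    every piece is at least [a], and the union bound sums the [delta_ i]. It is applied with
    [y = f x u] and [a = alpha * h x]. *)
Lemma hfun_ge_prob (R : realType) d (T : measurableType d)
    (P : probability T R) (n p : nat) (q : 'I_p.+1 -> nat)
    (c : forall i : 'I_p.+1, 'I_(q i).+1 -> 'cV[R]_n)
    (b : forall i : 'I_p.+1, 'I_(q i).+1 -> R)
    (a delta : R) (y : 'cV[R]_n) (G : T -> 'cV[R]_n) (delta_ : 'I_p.+1 -> R) :
  measurable_fun setT G -> (forall i, 0 < delta_ i) ->
  \sum_(i < p.+1) delta_ i <= delta ->
  (forall i, exists j, - quantile P (fun t => dotv (c i j) (G t)) (delta_ i) <=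
     dotv (c i j) y - (b i j + a)) ->
  ((1 - delta)%:E <= P [set t | (a <= hfun c b (y + G t))%R])%E.
Proof.
move=> mG delta_0 sum_delta exj.
pose j i := sval (cid (exj i)).
pose Z i t := dotv (c i (j i)) (G t).
have mZ i : measurable_fun setT (Z i).
  by apply: measurableT_comp mG; exact: measurable_dotv.
pose bad i := [set t | Z i t < quantile P (Z i) (delta_ i)].
have mbad i : measurable (bad i).
  rewrite (_ : bad i = setT `\`
      (setT `&` [set t | quantile P (Z i) (delta_ i) <= Z i t])).
    by apply: measurableD => //; exact: measurable_fun_le.
  by rewrite setTI setTD; apply/seteqP; split => t; rewrite /bad /= ltNge => /negP.
have mgood : measurable [set t | a <= hfun c b (y + G t)].
  rewrite -[X in measurable X]setTI; apply: measurable_fun_le => //.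
  apply: measurableT_comp (@measurable_hfun _ _ _ _ c b) _.
  exact: measurable_addmx.
have sub : ~` [set t | a <= hfun c b (y + G t)] `<=` \bigcup_(i in setT) bad i.
  move=> t; apply: contra_notP => /= nbad; apply: hfun_ge => i; exists (j i).
  have Zge : quantile P (Z i) (delta_ i) <= Z i t.
    by rewrite leNgt; apply/negP => Zt; apply: nbad; exists i.
  have := svalP (cid (exj i)); rewrite -/(j i) => yge.
  rewrite dotvD; move: Zge yge; rewrite /Z.
  set zz := dotv _ (G t); set u := dotv _ y; set qq := quantile _ _ _.
  lra.
have := content_sub_fsum P finite_finset (fun i _ => mbad i)
  (measurableC mgood) sub.
(* The union bound sums over a finite set; listing that set by [enum] turns the sum into the
   ordinary one over [i < p.+1]. *)
rewrite (_ : [set: 'I_p.+1] = [set` enum 'I_p.+1]); last first.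
  by apply/seteqP; split => i //= _; rewrite mem_enum.
rewrite -fsbig_seq ?enum_uniq// big_enum /= probability_setC// => Pbad.
have {}Pbad : (1 - P [set t | (a <= hfun c b (y + G t))%R] <= delta%:E)%E.
  apply: (le_trans Pbad); rewrite (le_trans _ (_ : (\sum_i delta_ i)%:E <= _)%E)//.
  rewrite -sumEFin; apply: lee_sum => i _; exact: quantile_lt_le.
rewrite EFinB leeBlDr// addeC -leeBlDr//.
by rewrite fin_num_measure.
Qed.

(** * Joint laws restricted to an event *)

Section joint_law.
Context (R : realType) d (Omega : measurableType d) (P : probability Omega R).
Context d1 d2 (T1 : measurableType d1) (T2 : measurableType d2).
Context (X : Omega -> T1) (Z : Omega -> T2) (G : set Omega).
Hypotheses (mX : measurable_fun setT X) (mZ : measurable_fun setT Z).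
Hypothesis mG : measurable G.

Let XZ w := (X w, Z w).

Let mXZ : measurable_fun setT XZ.
Proof. exact: measurable_fun_pair. Qed.

(* The rectangles suffice: both sides are finite measures in D. *)
Lemma indep_joint (E : set Omega) : measurable E ->
  (forall C A, measurable C -> measurable A ->
    P (G `&` X @^-1` C `&` Z @^-1` A `&` E) =
    (P (G `&` X @^-1` C `&` Z @^-1` A) * P E)%E) ->
  forall D, measurable D ->
    P (G `&` (fun w => (X w, Z w)) @^-1` D `&` E) =
    (P (G `&` (fun w => (X w, Z w)) @^-1` D) * P E)%E.
Proof.
move=> mE indep D mD.
have mGE : measurable (G `&` E) by exact: measurableI.
(* The factor [P E] is made a nonnegative real so that the right-hand side becomes a scaled measure
   [m2]. *)
pose e : {nonneg R} := NngNum (fine_ge0 (measure_ge0 P E)).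
pose m1 : {measure set (T1 * T2) -> \bar R} := pushforward (mrestr P mGE) XZ.
pose m2 : {measure set (T1 * T2) -> \bar R} :=
  mscale e (pushforward (mrestr P mG) XZ).
have e_E : (e%:num)%:E = P E by rewrite /= fineK// fin_num_measure.
have m1oo : (m1 mXZ setT < +oo)%E.
  by rewrite -ge0_fin_numE// /m1 /= /pushforward /mrestr /= fin_num_measure// setTI.
have m12 : m1 mXZ D = m2 mXZ D.
  apply: prod_measure_eq => // C A mC mA.
  rewrite /m1 /m2 /= /mscale /= /pushforward /mrestr.
  have -> : XZ @^-1` (C `*` A) = X @^-1` C `&` Z @^-1` A by [].
  rewrite setIA ![_ `&` G]setIC ![G `&` (_ `&` _)]setIA indep//.
  by rewrite fineK ?fin_num_measure// muleC.
move: m12; rewrite /m1 /m2 /= /mscale /= /pushforward /mrestr.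
by rewrite setIA ![_ `&` G]setIC fineK ?fin_num_measure// muleC.
Qed.

(** On rectangles the restricted law of [(X, Z)] is the product of the law of [X] on [G], left
    unnormalised, with [law]. The two measures therefore coincide, and the product measure is an
    integral over sections. *)
Lemma joint_law (law : probability T2 R) :
  (forall C A, measurable C -> measurable A ->
    P (G `&` X @^-1` C `&` Z @^-1` A) = (P (G `&` X @^-1` C) * law A)%E) ->
  forall D, measurable D ->
    P (G `&` (fun w => (X w, Z w)) @^-1` D) =
    (\int[pushforward (mrestr P mG) X]_x law (xsection D x))%E.
Proof.
move=> indep D mD.
pose m0 : {measure set T1 -> \bar R} := pushforward (mrestr P mG) X.
pose m1 : {measure set (T1 * T2) -> \bar R} := pushforward (mrestr P mG) XZ.
pose m2 : {measure set (T1 * T2) -> \bar R} := (m0 mX \x law)%E.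
have m1oo : (m1 mXZ setT < +oo)%E.
  by rewrite -ge0_fin_numE// /m1 /= /pushforward /mrestr /= fin_num_measure// setTI.
have : m1 mXZ D = m2 D.
  apply: prod_measure_eq => // C A mC mA.
  have -> : m2 (C `*` A) = (m0 mX C * law A)%E by exact: product_measure1E.
  rewrite /m1 /m0 /= /pushforward /mrestr.
  have -> : XZ @^-1` (C `*` A) = X @^-1` C `&` Z @^-1` A by [].
  by rewrite ![_ `&` G]setIC setIA indep.
by rewrite /m1 /m2 /= /pushforward /mrestr /= setIC.
Qed.

End joint_law.

(** * Independence from future noise and survival probabilities *)

Section survival.
Context (R : realType) d (Omega : measurableType d) (P : probability Omega R).
Context d1 d2 (T1 : measurableType d1) (T2 : measurableType d2).
Context (law : probability T2 R) (xi : nat -> {RV P >-> T2}).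
Hypothesis xi_iid : iid_with_law xi law.

(* The events determined by finitely many of the xi_j with j >= k. *)
Definition future (k : nat) (E : set Omega) : Prop :=
  exists (J : {fset nat}) (A : nat -> set T2),
    [/\ forall j, j \in J -> (k <= j)%N, forall j, measurable (A j) &
        E = \bigcap_(j in [set` J]) xi j @^-1` A j].

Lemma measurable_future k E : future k E -> measurable E.
Proof.
move=> [J [A [_ mA ->]]]; apply: fin_bigcap_measurable => // j _.
by rewrite -[X in measurable X]setTI; exact: measurable_funPT.
Qed.

Lemma futureT k : future k setT.
Proof.
by exists fset0, (fun=> setT); split => //; rewrite set_fset0 bigcap_set0.
Qed.

(** The indices of [E] are at least [k.+1], so [k] is new: mutual independence over the enlarged
    index set splits off exactly one factor. *)
Lemma future_extend k E A : future k.+1 E -> measurable A ->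
  future k (xi k @^-1` A `&` E) /\
  P (xi k @^-1` A `&` E) = (law A * P E)%E.
Proof.
move=> [J [B [kJ mB ->]]] mA; have [xi_indep xi_law] := xi_iid.
pose B' j := if j == k then A else B j.
have mB' j : measurable (B' j) by rewrite /B'; case: ifP.
have kNJ : k \notin J by apply/negP => /kJ; rewrite ltnn.
have B'J j : j \in J -> B' j = B j.
  by rewrite /B' => jJ; case: eqP => // jk; rewrite -jk jJ in kNJ.
have kJE : xi k @^-1` A `&` \bigcap_(j in [set` J]) xi j @^-1` B j =
    \bigcap_(j in [set` (k |` J)%fset]) xi j @^-1` B' j.
  apply/seteqP; split => w.
    move=> [wA wB] j /=; rewrite !inE => /orP[/eqP ->|jJ].
      by rewrite /B' eqxx.
    by rewrite B'J//; exact: wB.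
  move=> wB'; split.
    by have := wB' k; rewrite /= !inE /B' eqxx; exact.
  by move=> j /= jJ; rewrite -B'J//; apply: wB'; rewrite /= !inE jJ orbT.
split.
  exists (k |` J)%fset, B'; split => // j; rewrite !inE => /orP[/eqP ->//|/kJ].
  exact: ltnW.
rewrite kJE !xi_indep// big_fsetU1//= -(xi_law k)// /distribution /pushforward.
rewrite {1}/B' eqxx; congr (_ * _)%E.
by apply: eq_big_seq => j jJ; rewrite B'J.
Qed.

Context (Phi : nat -> T1 * T2 -> T1) (x : nat -> Omega -> T1) (N : nat).
Hypothesis mPhi : forall k, (k < N)%N -> measurable_fun setT (Phi k).
Hypothesis mx0 : measurable_fun setT (x 0%N).
Hypothesis x0_const : forall w w', x 0%N w = x 0%N w'.
Hypothesis x_step : forall k w, x k.+1 w = Phi k (x k w, xi k w).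
Context (S : set T1) (mS : measurable S).

(** Time [0] is included, so the current state lies in [S] already at the first step, where the
    one-step bound requires it. *)
Definition survive (k : nat) : set Omega :=
  [set w | forall j, (j <= k)%N -> S (x j w)].

Lemma measurable_state k : (k <= N)%N -> measurable_fun setT (x k).
Proof.
elim: k => [//|k IH kN]; rewrite (_ : x k.+1 = Phi k \o (fun w => (x k w, xi k w))).
  apply: measurableT_comp; first exact: mPhi.
  by apply: measurable_fun_pair; [exact/IH/ltnW|exact: measurable_funPT].
by apply/funext => w; rewrite x_step.
Qed.

Lemma surviveS k : survive k.+1 = survive k `&` x k.+1 @^-1` S.
Proof.
apply/seteqP; split => [w wS|w [wS wk] j].
  by split; [move=> j jk; apply: wS; exact: leqW|exact: wS].
by rewrite leq_eqVlt => /orP[/eqP ->//|]; exact: wS.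
Qed.

Lemma survive0 : survive 0%N = x 0%N @^-1` S.
Proof.
by apply/seteqP; split => [w /(_ 0%N)|w wS j]; [exact|rewrite leqn0 => /eqP ->].
Qed.

Lemma measurable_survive k : (k <= N)%N -> measurable (survive k).
Proof.
elim: k => [_|k IH kN]; rewrite ?survive0 ?surviveS.
  by rewrite -[X in measurable X]setTI; exact: mx0.
apply: measurableI; first exact/IH/ltnW.
by rewrite -[X in measurable X]setTI; exact: measurable_state.
Qed.

Lemma surviveS_joint k C : survive k.+1 `&` x k.+1 @^-1` C =
  survive k `&` (fun w => (x k w, xi k w)) @^-1` (Phi k @^-1` (S `&` C)).
Proof.
rewrite surviveS -setIA; congr (_ `&` _).
by apply/seteqP; split => w /=; rewrite x_step.
Qed.

(* The free set C carries the induction: x_(k+1) is a function of (x_k, xi_k), and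
   (x_k, xi_k) is controlled by its values on rectangles. *)
Lemma survive_future_indep k E C : (k <= N)%N -> future k E -> measurable C ->
  P (survive k `&` x k @^-1` C `&` E) = (P (survive k `&` x k @^-1` C) * P E)%E.
Proof.
elim: k E C => [|k IH] E C kN fE mC.
  rewrite survive0 -preimage_setI.
  (* The initial state is deterministic, so its event is either full or empty. *)
  have [[w Dw]|nD] := pselect (exists w, (S `&` C) (x 0%N w)).
    have -> : x 0%N @^-1` (S `&` C) = setT.
      by apply/seteqP; split => // w' _; rewrite /preimage /mkset (x0_const w' w).
    by rewrite setTI probability_setT mul1e.
  have -> : x 0%N @^-1` (S `&` C) = set0.
    by apply/seteqP; split => // w Dw; apply: nD; exists w.
  by rewrite set0I measure0 mul0e.
have kN' : (k <= N)%N := ltnW kN.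
have mD : measurable (Phi k @^-1` (S `&` C)).
  by rewrite -[X in measurable X]setTI; apply: mPhi => //; exact: measurableI.
rewrite surviveS_joint; apply: indep_joint => //.
- exact: measurable_state.
- exact: measurable_survive.
- exact: measurable_future fE.
move=> C' A mC' mA.
(* The event on [xi k] is itself in the future of time [k]: the induction hypothesis is used once
   with [E] attached and once without, and the two products are compared. *)
have [fAE PAE] := future_extend fE mA.
have [fA PA] := future_extend (futureT k.+1) mA.
rewrite -setIA IH// PAE muleA; congr (_ * _)%E.
by rewrite -[_ @^-1` A]setIT IH// PA probability_setT mule1.
Qed.

(** Survival at [k.+1] is an event on [(x k, xi k)] within [survive k]; integrating the noise out by
    [joint_law] leaves an integral whose integrand is at least [rho] on [S]. *)
Lemma survive_prob (rho : R) : 0 <= rho ->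
  (forall k, (k < N)%N -> forall y, S y ->
    (rho%:E <= law [set z | S (Phi k (y, z))])%E) ->
  (forall w, S (x 0%N w)) ->
  forall k, (k <= N)%N -> ((rho ^+ k)%:E <= P (survive k))%E.
Proof.
move=> rho0 step Sx0; elim=> [|k IH] kN.
  rewrite survive0 (_ : _ @^-1` _ = setT) ?probability_setT//.
  by apply/seteqP; split => // w _; exact: Sx0.
have kN' := ltnW kN; have mk := measurable_survive kN'.
have mxk := measurable_state kN'.
have mD : measurable (Phi k @^-1` S).
  by rewrite -[X in measurable X]setTI; exact: mPhi.
(* [surviveS_joint] is used with [C = setT]. *)
rewrite -[survive _]setIT -(preimage_setT (x k.+1)) surviveS_joint setIT.
rewrite (joint_law mxk _ mk (law := law))//; last first.
  move=> C A mC mA; have [fA PA] := future_extend (futureT k.+1) mA.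
  by rewrite -[_ @^-1` A]setIT survive_future_indep// PA probability_setT mule1.
pose nu : {measure set T1 -> \bar R} := pushforward (mrestr P mk) (x k).
(* Surviving up to [k] forces [x k] into [S], so [nu] gives [S] its full mass. *)
have nuS : nu mxk S = P (survive k).
  rewrite /nu /= /pushforward /mrestr; congr (P _).
  by apply/seteqP; split => [w []//|w wS]; split => //; exact: wS.
apply: (@le_trans _ _ (\int[nu mxk]_(y in S) cst rho%:E y)%E).
  by rewrite integral_cst// nuS exprS EFinM lee_wpmul2l// IH.
apply: (@le_trans _ _ (\int[nu mxk]_(y in S) law (xsection (Phi k @^-1` S) y))%E).
  apply: ge0_le_integral => //.
  - by apply: measurable_funTS; exact: measurable_fun_xsection.
  - move=> y Sy /=; rewrite xsectionE; exact: step.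
apply: ge0_subset_integral => //; exact: measurable_fun_xsection.
Qed.

End survival.

(** * The barrier property and the exit bound *)

Theorem corollary1 (R : realType) (n m r : nat)
  (* input set *)
  (U : set 'cV[R]_m) (U_nonempty : U !=set0) (U_closed : closed U)
  (U_convex : @convex_set R 'cV[R]_m U)
  (* dynamics; only the values of f on inputs of U matter *)
  (f : 'cV[R]_n -> 'cV[R]_m -> 'cV[R]_n)
  (g : 'cV[R]_n -> 'cV[R]_r -> 'cV[R]_n)
  (f_meas : measurable_fun ([set: 'cV[R]_n] `*` U)
     (fun y : 'cV[R]_n * 'cV[R]_m => f y.1 y.2))
  (g_meas : measurable_fun [set: 'cV[R]_n * 'cV[R]_r]
     (fun y : 'cV[R]_n * 'cV[R]_r => g y.1 y.2))
  (* noise *)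
  (d : measure_display) (Omega : measurableType d) (P : probability Omega R)
  (law : probability 'cV[R]_r R) (xi : nat -> {RV P >-> 'cV[R]_r})
  (xi_iid : iid_with_law xi law)
  (* barrier function *)
  (p : nat) (q : 'I_p.+1 -> nat)
  (c : forall i : 'I_p.+1, 'I_(q i).+1 -> 'cV[R]_n)
  (b : forall i : 'I_p.+1, 'I_(q i).+1 -> R)
  (alpha : R) (alpha01 : 0 <= alpha <= 1)
  (* horizon and risk levels *)
  (N : nat) (N_ge1 : (1 <= N)%N)
  (eps delta : R) (eps01 : 0 < eps < 1) (delta01 : 0 < delta < 1)
  (delta_le : delta <= 1 - (1 - eps) `^ (N%:R^-1))
  (* policy *)
  (kappa : nat -> 'cV[R]_n -> 'cV[R]_m)
  (kappa_U : forall k, (k < N)%N -> forall x, U (kappa k x))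
  (kappa_meas : forall k, (k < N)%N -> measurable_fun setT (kappa k))
  (kappa_cond : forall x, safe_set (hfun c b) x ->
     forall k, (k < N)%N ->
     exists delta_ : 'I_p.+1 -> R,
       [/\ forall i, 0 < delta_ i < 1,
           \sum_(i < p.+1) delta_ i <= delta
         & forall i, exists j : 'I_(q i).+1,
             dotv (c i j) (f x (kappa k x)) - btilde c b alpha j x >=
             - quantile law (fun z => dotv (c i j) (g x z)) (delta_ i)]) :
  is_prob_CBF f g U law delta (hfun c b) /\
  (forall x, safe_set (hfun c b) x ->
     (exit_prob f g P kappa xi (safe_set (hfun c b)) N x <= eps%:E)%E).

Proof.
set h := hfun c b.
have mg x : measurable_fun setT (g x).
  exact: measurable_fun_pair2 g_meas.
have step x k : safe_set h x -> (k < N)%N ->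
    ((1 - delta)%:E <=
      law [set z | (alpha * h x <= h (dyn f g x (kappa k x) z))%R])%E.
  move=> Sx kN; have [delta_ [delta_01 sum_delta exj]] := kappa_cond x Sx k kN.
  apply: (hfun_ge_prob (mg x) _ sum_delta) => // i.
  by have /andP[] := delta_01 i.
split.
  (* The first policy map supplies the input; it exists since [N] is at least 1. *)
  exists alpha; split => // x Sx; exists (kappa 0%N x).
  by split; [exact: kappa_U|exact: step].
move=> x Sx; set S := safe_set h.
have mS : measurable S.
  rewrite /S /safe_set -[X in measurable X]setTI.
  by apply: measurable_fun_le => //; exact: measurable_hfun.
pose Phi k (y : 'cV[R]_n * 'cV[R]_r) := dyn f g y.1 (kappa k y.1) y.2.
have mPhi k : (k < N)%N -> measurable_fun setT (Phi k).
  move=> kN; apply: measurable_addmx; last exact: g_meas.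
  (* [f] is measurable only on states times [U]. The graph map of [kappa k] lands there, and that
     domain is measurable because [U] is closed. *)
  have mf : measurable_fun setT (fun y => f y (kappa k y)).
    apply: (@measurable_comp _ _ _ _ _ _ ([set: 'cV[R]_n] `*` U)
      (fun y : 'cV[R]_n * 'cV[R]_m => f y.1 y.2) _ (fun y => (y, kappa k y))) => //.
    - by apply: measurableX => //; exact: closed_measurable_mx.
    - by move=> _ [y _ <-]; split => //; exact: kappa_U.
    - by apply: measurable_fun_pair => //; exact: kappa_meas.
  exact: (measurableT_comp mf measurable_fst).
pose X := trajectory f g kappa xi x.
have msurvive : measurable (survive X S N).
  by apply: (measurable_survive (xi := xi) mPhi) => //; exact: measurable_cst.
have survive_ge : (((1 - delta) ^+ N)%:E <= P (survive X S N))%E.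
  apply: (survive_prob xi_iid mPhi) => //.
  - exact: measurable_cst.
  - by rewrite subr_ge0 ltW//; case/andP: delta01.
  - move=> k kN y Sy; apply: (le_trans (step y k Sy kN)).
    have mdyn : measurable_fun setT (dyn f g y (kappa k y)).
      exact: (measurable_fun_pair2 (f := Phi k) y (mPhi k kN)).
    apply: le_measure.
    + rewrite inE -[X in measurable X]setTI; apply: measurable_fun_le => //.
      exact: measurableT_comp (@measurable_hfun _ _ _ _ c b) mdyn.
    + by rewrite inE -[X in measurable X]setTI; exact: mdyn.
    (* Since [alpha] and [h y] are nonnegative, the barrier inequality implies that the next state
       is safe. *)
    + move=> z /=; apply: le_trans; apply: mulr_ge0 => //; by case/andP: alpha01.
(* Exit times start at 1 while survival also covers time 0; the two agree because the initial state
   is safe. *)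
have -> : exit_prob f g P kappa xi S N x = P (~` survive X S N).
  congr (P _); apply/seteqP; split => w /=.
    by move=> [k [/andP[_ kN] nS]] wS; apply: nS; exact: wS.
  move=> nsurv; apply: contrapT => noexit; apply: nsurv => -[|k] kN //.
  by apply: contrapT => nS; apply: noexit; exists k.+1.
rewrite probability_setC//.
have eps_le : (1 - eps <= (1 - delta) ^+ N)%R.
  have e0 : 0 <= 1 - eps by rewrite subr_ge0 ltW//; case/andP: eps01.
  have delta0 : 0 <= 1 - delta by rewrite subr_ge0 ltW//; case/andP: delta01.
  (* Written as an [N]-th power, the claim follows from [delta_le] by monotonicity of powers on
     nonnegative reals. *)
  have -> : 1 - eps = ((1 - eps) `^ N%:R^-1) ^+ N.
    by rewrite -powR_mulrn ?powR_ge0// -powRrM mulVf ?powRr1// pnatr_eq0 -lt0n.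
  by apply: lerXn2r; rewrite ?nnegrE ?powR_ge0// lerBrDr addrC -lerBrDr.
rewrite leeBlDr ?fin_num_measure//.
rewrite addeC -leeBlDr// -EFinB (le_trans _ survive_ge)// lee_fin//.
Qed.
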